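(* Let $k\in\mathbb{Z}$ and $n,m\in\mathbb{Z}^+$. Then $\chi_{n,k}(K_m)=m$, $\chi_{n,k}(S_m)=2$, and $\chi_{n,k}(F_m)=3$.
   Context: $K_m$ is the complete graph on $m$ vertices; $S_m$ is the star on $m+1$ vertices (one center adjacent to $m$ leaves); $F_m$ is the friendship graph consisting of $m$ copies of the cycle $C_3$ joined at a single common vertex. For a graph $G=(V,E)$, a labeling $\ell:V\to\mathbb{Z}$ is proper if adjacent vertices get distinct labels, its order is the size of its image, and it is a closed coloring with remainder $k\bmod n$ if $\sum_{w\in N[v]}\ell(w)\equiv k\pmod n$ for every $v$, where $N[v]$ is the closed neighborhood of $v$. $\chi_{n,k}(G)$ is the minimum order of a proper closed coloring with remainder $k\bmod n$ (it does not exist if there is none). *)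

(* Defs.v *)
From mathcomp Require Import all_boot all_order all_algebra.
From mathcomp Require Import boolp.

Set Implicit Arguments.
Unset Strict Implicit.
Unset Printing Implicit Defensive.

Record sgraph := SGraph {
  vertex :> finType;
  adj : rel vertex;
  adj_sym : symmetric adj;
  adj_irrefl : irreflexive adj }.

Definition closed_nbhd (G : sgraph) (v : G) : {set G} :=
  [set w | (w == v) || adj v w].

Definition proper_labeling (G : sgraph) (l : G -> int) : Prop :=
  forall u v : G, adj u v -> l u <> l v.

Definition labeling_order (G : sgraph) (l : G -> int) : nat := size (undup (codom l)).

Definition closed_coloring (n : nat) (k : int) (G : sgraph) (l : G -> int) :
    Prop :=
  forall v : G, (\sum_(w in closed_nbhd v) l w = k %[mod n%:Z])%Z.

Definition proper_closed_coloring_order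
    (n : nat) (k : int) (G : sgraph) (r : nat) : Prop :=
  exists l : G -> int,
    [/\ proper_labeling l, closed_coloring n k l & labeling_order l = r].

(* [None] when G has no proper closed coloring with remainder k mod n. *)
Definition chi (n : nat) (k : int) (G : sgraph) : option nat :=
  match pselect (exists r, `[< proper_closed_coloring_order n k G r >]) with
  | left ex_r => Some (ex_minn ex_r)
  | right _ => None
  end.

Definition complete_adj (m : nat) : rel 'I_m := fun x y => x != y.

Lemma complete_adj_sym m : symmetric (@complete_adj m).
Proof. by move=> x y; rewrite /complete_adj eq_sym. Qed.

Lemma complete_adj_irrefl m : irreflexive (@complete_adj m).
Proof. by move=> x; rewrite /complete_adj eqxx. Qed.

Definition complete_graph (m : nat) : sgraph :=
  SGraph (@complete_adj_sym m) (@complete_adj_irrefl m).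

(* [None] is the center, [Some i] the i-th leaf. *)
Definition star_adj (m : nat) : rel (option 'I_m) := fun x y =>
  match x, y with
  | None, Some _ | Some _, None => true
  | _, _ => false
  end.

Lemma star_adj_sym m : symmetric (@star_adj m).
Proof. by case=> [i|] [j|]. Qed.

Lemma star_adj_irrefl m : irreflexive (@star_adj m).
Proof. by case. Qed.

Definition star_graph (m : nat) : sgraph :=
  SGraph (@star_adj_sym m) (@star_adj_irrefl m).

(* [None] is the common vertex; the i-th triangle consists of [None],
   [Some (i, false)] and [Some (i, true)]. *)
Definition friendship_adj (m : nat) : rel (option ('I_m * bool)) := fun x y =>
  match x, y with
  | None, Some _ | Some _, None => true
  | Some (i, b), Some (j, c) => (i == j) && (b != c)
  | None, None => false
  end.

Lemma friendship_adj_sym m : symmetric (@friendship_adj m).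
Proof. by case=> [[i b]|] [[j c]|] //=; rewrite eq_sym [b == c]eq_sym. Qed.

Lemma friendship_adj_irrefl m : irreflexive (@friendship_adj m).
Proof. by case=> [[i b]|] //=; rewrite !eqxx. Qed.

Definition friendship_graph (m : nat) : sgraph :=
  SGraph (@friendship_adj_sym m) (@friendship_adj_irrefl m).

(* Main.v *)
Require Import Defs.
From mathcomp Require Import all_boot all_order all_algebra.
From mathcomp Require Import boolp zify.

(** All three graphs have a vertex u adjacent to every other vertex, so every
closed neighborhood contains u. Hence labeling u by k and all other vertices by
multiples of n always gives a closed coloring with remainder k mod n. A proper
r-coloring of the graph can be realized by such labels, because there are
infinitely many multiples of n different from k, and an r-clique shows that r
labels are necessary. *)

Import Order.TTheory GRing.Theory Num.Theory.

(** The lower bound ranges over all proper labelings, closed or not, because a clique bounds them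
    all. It also turns the upper bound on the order of [l] into an equality. *)
Lemma chi_eq (n : nat) (k : int) (G : sgraph) (r : nat) (l : G -> int) :
    proper_labeling l -> closed_coloring n k l ->
    (labeling_order l <= r) ->
    (forall l' : G -> int, proper_labeling l' -> (r <= labeling_order l')) ->
  chi n k G = Some r.
Proof.
move=> l_proper l_closed l_le r_min.
rewrite /chi; case: pselect => [ex_r|[]]; last first.
  by exists (labeling_order l); apply/asboolP; exists l.
congr Some; case: ex_minnP => s /asboolP[l' [l'_proper _ <-]] s_min.
apply/eqP; rewrite eqn_leq r_min // andbT (leq_trans _ l_le) //.
by apply: s_min; apply/asboolP; exists l.
Qed.

Lemma clique_leq_labeling_order (G : sgraph) (r : nat) (q : 'I_r -> G) (l : G -> int) :
    (forall i j, i != j -> adj (q i) (q j)) -> proper_labeling l ->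
  (r <= labeling_order l).
Proof.
move=> q_clique l_proper.
have lq_inj : injective (l \o q).
  move=> i j /= lq_eq; apply/eqP/negPn/negP => /q_clique /l_proper; exact.
rewrite -[r in (r <= _)](size_enum_ord r) -(size_map (l \o q)).
apply: uniq_leq_size => [|x /mapP[i _ ->]]; first by rewrite map_inj_uniq ?enum_uniq.
by rewrite mem_undup; apply: codom_f.
Qed.

Lemma labeling_order_comp_leq (G : sgraph) (r : nat) (c : G -> 'I_r) (h : 'I_r -> int) :
  (labeling_order (h \o c) <= r).
Proof.
rewrite -[r in (_ <= r)](size_enum_ord r) -(size_map h).
apply: uniq_leq_size => [|x]; first exact: undup_uniq.
by rewrite mem_undup => /codomP[v ->]; apply: map_f; rewrite mem_enum.
Qed.

Lemma chi_universal_vertex (n : nat) (k : int) (G : sgraph) (u : G) (r : nat)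
    (c : G -> 'I_r) (q : 'I_r -> G) :
    (0 < n) -> (forall v, v != u -> adj u v) ->
    (forall v w, adj v w -> c v != c w) ->
    (forall i j, i != j -> adj (q i) (q j)) ->
  chi n k G = Some r.
Proof.
move=> n_gt0 u_adj c_proper q_clique.
(* Every other vertex is adjacent to [u], so [u] is alone in its color class and that color can be
   sent to [k]. *)
have c_eq_u v : (c v == c u) = (v == u).
  apply/eqP/eqP => [cvu|-> //]; apply/eqP/negPn/negP => /u_adj /c_proper.
  by rewrite cvu eqxx.
(* As [n] is at least 1, the offset [|k|] plus one pushes [n * t i] above [k]; the summand [i] keeps
   these multiples distinct. *)
pose t (i : 'I_r) : nat := (i + `|k|).+1.
pose h (i : 'I_r) : int := if i == c u then k else (n%:Z * (t i)%:Z)%R.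
have t_gt i : (k < n%:Z * (t i)%:Z)%R by rewrite /t; nia.
have h_inj : injective h.
  move=> i j; rewrite /h.
  case: eqP => [->|_]; case: eqP => [->|_] // hij.
  - by move: (t_gt j); rewrite -hij ltxx.
  - by move: (t_gt i); rewrite hij ltxx.
  - have n_neq0 : (n%:Z != 0)%R by lia.
    by move/(mulfI n_neq0): hij => -[] /addIn /val_inj.
apply: (@chi_eq _ _ _ _ (h \o c)).
- by move=> v w /c_proper /eqP cvw /h_inj.
(* Splitting off the label [k] of [u] leaves a sum of multiples of [n]. *)
- move=> v; rewrite (bigD1 u) /=; last first.
    rewrite inE; case: eqVneq => //= uv.
    by rewrite adj_sym u_adj // eq_sym.
  have -> : h (c u) = k by rewrite /h eqxx.
  rewrite (eq_bigr (fun w => n%:Z * (t (c w))%:Z)%R) => [|w /andP[_ wu]].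
    by rewrite -mulr_sumr addrC mulrC modzMDl.
  by rewrite /h c_eq_u (negPf wu).
- exact: labeling_order_comp_leq.
- by move=> l'; apply: clique_leq_labeling_order q_clique.
Qed.

Theorem theorem4p1 (k : int) (n m : nat) (n_gt0 : (0 < n)%N) (m_gt0 : (0 < m)%N) :
  [/\ chi n k (complete_graph m) = Some m,
      chi n k (star_graph m) = Some 2
    & chi n k (friendship_graph m) = Some 3].
Proof.
pose i0 := Ordinal m_gt0.
split.
(* Any vertex of $K_m$ is universal, and the whole graph is its own clique. *)
- apply: (@chi_universal_vertex _ _ (complete_graph m) i0 _ id id) => // v.
  by rewrite eq_sym.
- pose c (v : option 'I_m) : 'I_2 := if v is Some _ then inord 1 else inord 0.
  pose q (i : 'I_2) : option 'I_m := if i == ord0 then None else Some i0.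
  apply: (@chi_universal_vertex _ _ (star_graph m) None _ c q) => //.
  + by case.
  + by case=> [v|] [w|] //= _; rewrite -val_eqE /= !inordK.
  + by case=> [[|[|//]] ?] [[|[|//]] ?].
- pose c (v : option ('I_m * bool)) : 'I_3 :=
    if v is Some (_, b) then (if b then inord 2 else inord 1) else inord 0.
  (* The clique is the triangle of index [i0]: the test [i == ord_max] sends 1 and 2 to its two
     outer vertices. *)
  pose q (i : 'I_3) : option ('I_m * bool) :=
    if i == ord0 then None else Some (i0, i == ord_max).
  apply: (@chi_universal_vertex _ _ (friendship_graph m) None _ c q) => //.
  + by case.
  + by case=> [[v [|]]|] [[w [|]]|] //=; rewrite ?andbF // => _;
      rewrite -val_eqE /= !inordK.
  + by case=> [[|[|[|//]]] ?] [[|[|[|//]]] ?] //=; rewrite eqxx.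
Qed.
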